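(* Let $n\ge 2$, let $M>0$ and let $G\subsetneq\mathbb{R}^n$ be a domain that is starlike with respect to a point $x\in G$. Then the $j$-ball $B_j(x,M)$ of $G$ is starlike with respect to $x$.
   Context: For a domain $G\subsetneq\mathbb{R}^n$, $n\ge 2$, and $x\in G$ let $d(x)$ denote the Euclidean distance from $x$ to $\partial G$. The $j$-metric on $G$ is $$j_G(x,y)=\log\left(1+\frac{|x-y|}{\min\{d(x),d(y)\}}\right),\qquad x,y\in G.$$ For $x\in G$ and $M>0$ the $j$-ball is $B_j(x,M)=\{y\in G: j_G(x,y)<M\}$. A bounded domain $D\subset\mathbb{R}^n$ is called starlike with respect to a point $x\in D$ if each line segment from $x$ to a point $y\in D$ is contained in $D$. *)

(* Defs.v *)
From mathcomp Require Import all_boot all_order all_algebra.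
From mathcomp Require Import all_classical all_reals all_analysis.

Set Implicit Arguments.
Unset Strict Implicit.
Unset Printing Implicit Defensive.

Import Order.TTheory GRing.Theory Num.Theory.
Import numFieldNormedType.Exports.

Local Open Scope classical_set_scope.
Local Open Scope ring_scope.

(* Points of R^n are row vectors. The library's norm on 'rV[R]_n is the sup
   norm; as it is equivalent to the Euclidean norm, the library notions open,
   connected, closure, interior and bounded_set are the Euclidean ones.
   Distances, in contrast, are computed with the norm below. *)
Definition enorm (R : realType) (n : nat) (v : 'rV[R]_n) : R :=
  Num.sqrt (\sum_i v ord0 i ^+ 2).

Definition domain (R : realType) (n : nat) (G : set 'rV[R]_n) : Prop :=
  [/\ G !=set0, open G & connected G].

Definition boundary (R : realType) (n : nat) (G : set 'rV[R]_n)
  : set 'rV[R]_n := closure G `\` interior G.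

(* The infimum is over a nonempty set when G is a domain other than R^n;
   inf set0 is 0. *)
Definition dist_boundary (R : realType) (n : nat) (G : set 'rV[R]_n)
    (x : 'rV[R]_n) : R :=
  inf [set enorm (x - z) | z in boundary G].

(* Meaningful for x and y in G only. *)
Definition jmetric (R : realType) (n : nat) (G : set 'rV[R]_n)
    (x y : 'rV[R]_n) : R :=
  ln (1 + enorm (x - y) / Num.min (dist_boundary G x) (dist_boundary G y)).

Definition jball (R : realType) (n : nat) (G : set 'rV[R]_n)
    (x : 'rV[R]_n) (M : R) : set 'rV[R]_n :=
  [set y | G y /\ jmetric G x y < M].

Definition segment (R : realType) (n : nat) (x y : 'rV[R]_n)
  : set 'rV[R]_n := [set (1 - t) *: x + t *: y | t in `[0, 1]].

(* Being a bounded domain that contains x is part of being starlike. *)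
Definition starlike (R : realType) (n : nat) (D : set 'rV[R]_n)
    (x : 'rV[R]_n) : Prop :=
  [/\ domain D, bounded_set D, D x & forall y, D y -> segment x y `<=` D].

(* Main.v *)
Require Import Defs.
From mathcomp Require Import all_boot all_order all_algebra.
From mathcomp Require Import all_classical all_reals all_analysis.
From mathcomp Require Import ring.
Import Order.TTheory GRing.Theory Num.Theory.
Import numFieldNormedType.Exports.
Local Open Scope classical_set_scope.
Local Open Scope ring_scope.
Set Implicit Arguments.
Unset Strict Implicit.

(** Write d for the distance to the boundary of G and r = e^M - 1.
    Exponentiating, a point y of G lies in the j-ball exactly when
    |x - y| < r d(x) and |x - y| < r d(y) ([jballP]). Let z = (1 - t) x + t y
    be a point of the segment from x to such a y. Then |x - z| = t |x - y|, so
    the first inequality survives for t <= 1, and the second one survives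
    because d(z) >= t d(y) ([dist_boundary_segment]): the Euclidean ball of
    radius d(y) about y lies in G ([ball_dist_boundary_sub]), and contracting
    it towards x by the factor t gives the ball of radius t d(y) about z, which
    lies in G as G is starlike with respect to x. Hence segments from x stay in
    the j-ball ([jball_segment]).

    The remaining requirements on a bounded starlike domain are soft. The
    j-ball is open because d is 1-Lipschitz and the two inequalities are strict
    ([open_jball]), connected because it is a union of segments through x
    ([connected_starshaped]), and bounded because G is.

    That the ball of radius d(y) lies in G rests on connectedness of segments:
    a segment that leaves an open set meets its boundary
    ([segment_meets_boundary]). The same fact makes the boundary of G nonempty,
    so that d is an infimum over a nonempty set. *)

(** * The Euclidean norm on row vectors *)

Section EuclideanNorm.
Variables (R : realType) (n : nat).
Implicit Types (u v : 'rV[R]_n) (a : R).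

Lemma enorm_ge0 v : 0 <= enorm v.
Proof. exact: sqrtr_ge0. Qed.

Lemma sqr_enorm v : enorm v ^+ 2 = \sum_i v ord0 i ^+ 2.
Proof. by rewrite sqr_sqrtr// sumr_ge0// => i _; rewrite sqr_ge0. Qed.

Lemma enormZ a v : enorm (a *: v) = `|a| * enorm v.
Proof.
rewrite /enorm -sqrtr_sqr -sqrtrM ?sqr_ge0// mulr_sumr.
by congr Num.sqrt; apply: eq_bigr => i _; rewrite mxE exprMn.
Qed.

Lemma enorm0 : enorm (0 : 'rV[R]_n) = 0.
Proof. by rewrite -(scale0r 0) enormZ normr0 mul0r. Qed.

Lemma enormN v : enorm (- v) = enorm v.
Proof. by rewrite -scaleN1r enormZ normrN1 mul1r. Qed.

Lemma enorm_distC u v : enorm (u - v) = enorm (v - u).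
Proof. by rewrite -enormN opprB. Qed.

(** Cauchy-Schwarz. With N = |v|^2 and c = u.v, the vector N u - c v is N times
    the component of u orthogonal to v; its squared norm is
    N (|u|^2 |v|^2 - c^2). *)
Lemma dot_le_enorm u v :
  \sum_i u ord0 i * v ord0 i <= enorm u * enorm v.
Proof.
have [v0|v_neq0] := eqVneq (enorm v) 0.
  have vi0 i : v ord0 i = 0.
    apply/eqP; rewrite -sqrf_eq0 eq_le sqr_ge0 andbT.
    have <- : enorm v ^+ 2 = 0 by rewrite v0 expr0n.
    rewrite sqr_enorm (bigD1 i)//= lerDl sumr_ge0// => j _.
    exact: sqr_ge0.
  by rewrite v0 mulr0 big1// => i _; rewrite vi0 mulr0.
have v2_gt0 : 0 < enorm v ^+ 2 by rewrite exprn_even_gt0.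
have [c Ec] : {c | c = \sum_i u ord0 i * v ord0 i} by eexists.
rewrite -Ec.
suff c2_le : c ^+ 2 <= (enorm u * enorm v) ^+ 2.
  apply: le_trans (ler_norm c) _.
  by rewrite -ler_sqr ?nnegrE ?mulr_ge0 ?enorm_ge0// real_normK ?num_real.
have : 0 <= \sum_i (enorm v ^+ 2 * u ord0 i - c * v ord0 i) ^+ 2.
  by apply: sumr_ge0 => i _; exact: sqr_ge0.
have -> : \sum_i (enorm v ^+ 2 * u ord0 i - c * v ord0 i) ^+ 2 =
    enorm v ^+ 2 * ((enorm u * enorm v) ^+ 2 - c ^+ 2).
  have -> : \sum_i (enorm v ^+ 2 * u ord0 i - c * v ord0 i) ^+ 2 =
      (enorm v ^+ 2) ^+ 2 * (\sum_i u ord0 i ^+ 2)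
      - 2 * enorm v ^+ 2 * c * (\sum_i u ord0 i * v ord0 i)
      + c ^+ 2 * (\sum_i v ord0 i ^+ 2).
    rewrite !mulr_sumr -sumrB -big_split/=.
    by apply: eq_bigr => i _; ring.
  by rewrite -!sqr_enorm -Ec; ring.
by rewrite pmulr_rge0// subr_ge0.
Qed.

Lemma ler_enormD u v : enorm (u + v) <= enorm u + enorm v.
Proof.
rewrite -ler_sqr ?nnegrE ?addr_ge0 ?enorm_ge0// sqrrD !sqr_enorm.
have -> : \sum_i (u + v) ord0 i ^+ 2 = \sum_i u ord0 i ^+ 2
    + (\sum_i u ord0 i * v ord0 i) *+ 2 + \sum_i v ord0 i ^+ 2.
  rewrite -sumrMnl -!big_split/=.
  by apply: eq_bigr => i _; rewrite mxE sqrrD.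
by rewrite lerD2r lerD2l lerMn2r dot_le_enorm orbT.
Qed.

(** This compares the Euclidean norm with the sup norm, which defines the
    topology of row vectors. *)
Lemma norm_coord_le_enorm v i : `|v ord0 i| <= enorm v.
Proof.
rewrite -sqrtr_sqr ler_wsqrtr// (bigD1 i)//= lerDl sumr_ge0// => j _.
exact: sqr_ge0.
Qed.

Lemma enorm_continuous : continuous (@enorm R n).
Proof.
move=> v; apply: (@continuous_comp _ _ _ (fun v => \sum_i v ord0 i ^+ 2)
    Num.sqrt); last exact: sqrt_continuous.
apply: continuous_big; first exact: add_continuous.
move=> i _ w.
by apply: (@continuousM R 'rV[R]_n (fun w => w ord0 i) (fun w => w ord0 i));
  exact: coord_continuous.
Qed.

Lemma enorm_dist_continuous u : continuous (fun v => enorm (u - v)).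
Proof.
move=> v; apply: (@continuous_comp _ _ _ (fun v => u - v) (@enorm R n)).
  by apply: (@continuousB R 'rV[R]_n); [exact: cst_continuous|exact: cvg_id].
exact: enorm_continuous.
Qed.

End EuclideanNorm.

(** * Segments *)

Section Segments.
Variables (R : realType) (n : nat).
Implicit Types (x y : 'rV[R]_n).

Lemma connected_segment x y : connected (segment x y).
Proof.
apply: connected_continuous_connected; first exact: segment_connected.
apply: continuous_subspaceT => t.
apply: cvgD; last by apply: cvgZr_tmp; exact: cvg_id.
by apply: cvgZr_tmp; apply: cvgB; [exact: cvg_cst|exact: cvg_id].
Qed.

Lemma segment_l x y : segment x y x.
Proof.
exists 0; last by rewrite subr0 scale1r scale0r addr0.
by rewrite /= in_itv/= lexx ler01.
Qed.

Lemma segment_r x y : segment x y y.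
Proof.
exists 1; last by rewrite subrr scale1r scale0r add0r.
by rewrite /= in_itv/= lexx ler01.
Qed.

End Segments.

(** * Distance to the boundary of an open set *)

Section Boundary.
Variables (R : realType) (n : nat) (G : set 'rV[R]_n).
Hypothesis G_open : open G.
Implicit Types (x y z w : 'rV[R]_n).

Lemma boundary_open : boundary G = closure G `\` G.
Proof. by rewrite /boundary; have /interior_id -> := G_open. Qed.

(** Otherwise the trace of G on the segment equals the trace of its closure, so
    it is clopen in the segment and hence is the whole segment. *)
Lemma segment_meets_boundary y w :
  G y -> ~ G w -> exists2 b, boundary G b & segment y w b.
Proof.
move=> Gy NGw; apply: contrapT => noboundary; apply: NGw.
have cl_eq : segment y w `&` G = segment y w `&` closure G.
  apply/seteqP; split=> [z [yz Gz]|z [yz cGz]].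
    by split=> //; exact: subset_closure.
  split=> //; apply: contrapT => NGz; apply: noboundary.
  by exists z => //; rewrite boundary_open.
have [] // : (segment y w `&` G) w.
rewrite (@connected_segment R n y w (segment y w `&` G)).
- exact: segment_r.
- by exists y; split=> //; exact: segment_l.
- by exists G.
- by exists (closure G) => //; exact: closed_closure.
Qed.

Lemma boundary_nonempty y : G y -> G `<` setT -> boundary G !=set0.
Proof.
move=> Gy [_ /nonsubset[w [_ NGw]]].
by have [b Gb _] := segment_meets_boundary Gy NGw; exists b.
Qed.

Lemma dist_boundary_le y b :
  boundary G b -> dist_boundary G y <= enorm (y - b).
Proof.
move=> Gb; apply: ge_inf; last by exists b.
by exists 0 => _ [z _ <-]; exact: enorm_ge0.
Qed.

(** The segment from y to a point w outside G meets the boundary, at a point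
    that is no farther from y than w is. *)
Lemma ball_dist_boundary_sub y w :
  G y -> enorm (y - w) < dist_boundary G y -> G w.
Proof.
move=> Gy yw; apply: contrapT => NGw.
have [_ /[swap] [[t /= + <-]]] := segment_meets_boundary Gy NGw.
rewrite in_itv/= => /andP[t0 t1] /(dist_boundary_le y).
have -> : y - ((1 - t) *: y + t *: w) = t *: (y - w).
  by apply/rowP => i; rewrite !mxE; ring.
rewrite enormZ ger0_norm// => /(lt_le_trans yw); rewrite ltNge => /negP; apply.
by rewrite ler_piMl ?enorm_ge0.
Qed.

Hypothesis G_boundary : boundary G !=set0.

Lemma le_dist_boundary y m :
  (forall b, boundary G b -> m <= enorm (y - b)) -> m <= dist_boundary G y.
Proof.
move=> mG; apply: lb_le_inf; last by move=> _ [b Gb <-]; exact: mG.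
by have [b Gb] := G_boundary; exists (enorm (y - b)); exists b.
Qed.

Lemma dist_boundary_ge0 y : 0 <= dist_boundary G y.
Proof. by apply: le_dist_boundary => b _; exact: enorm_ge0. Qed.

(** A sup-norm ball about y inside G contains no boundary point, and the
    Euclidean norm dominates the sup norm. *)
Lemma dist_boundary_gt0 y : G y -> 0 < dist_boundary G y.
Proof.
move=> Gy; have /nbhs_ballP[e /= e0 eG] : nbhs y G by exact: open_nbhs_nbhs.
apply: lt_le_trans e0 _; apply: le_dist_boundary => b.
rewrite boundary_open => -[_ NGb]; rewrite leNgt; apply/negP => yb.
apply: NGb; apply: eG; split; first exact: le_lt_trans (enorm_ge0 _) yb.
move=> i j; rewrite (ord1 i) -ball_normE/=; apply: le_lt_trans yb.
by have := norm_coord_le_enorm (y - b) j; rewrite !mxE.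
Qed.

Lemma dist_boundary_lipschitz y z :
  dist_boundary G y <= enorm (y - z) + dist_boundary G z.
Proof.
rewrite -lerBlDl; apply: le_dist_boundary => b Gb; rewrite lerBlDl.
apply: le_trans (dist_boundary_le y Gb) _.
by rewrite -[y - b](subrKA z) ler_enormD.
Qed.

Lemma dist_boundary_continuous : continuous (dist_boundary G).
Proof.
move=> y; apply/(cvgrPdist_le (FF := nbhs_filter y)) => e e0.
have near_y : \forall z \near y, enorm (y - z) <= e.
  have /(cvgrPdist_le (FF := nbhs_filter y))/(_ _ e0) :=
    @enorm_dist_continuous R n y y.
  apply: filterS => z.
  by rewrite subrr enorm0 sub0r normrN ger0_norm ?enorm_ge0.
apply: filterS near_y => z yz; rewrite ler_distlC lerBlDr.
apply/andP; split.
  apply: le_trans (dist_boundary_lipschitz y z) _.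
  by rewrite [leLHS]addrC lerD2l.
apply: le_trans (dist_boundary_lipschitz z y) _.
by rewrite enorm_distC [leLHS]addrC lerD2l.
Qed.

(** Exponentiate and clear the denominator min(d(x), d(y)), which is positive.
    The sign of M matters because e^M - 1 is distributed over that minimum. *)
Lemma jballP x M y : 0 <= M -> G x ->
  jball G x M y <->
  [/\ G y, enorm (x - y) < (expR M - 1) * dist_boundary G x &
           enorm (x - y) < (expR M - 1) * dist_boundary G y].
Proof.
move=> M0 Gx; suff E : G y -> (jmetric G x y < M) =
    (enorm (x - y) < (expR M - 1) * dist_boundary G x) &&
    (enorm (x - y) < (expR M - 1) * dist_boundary G y).
  split=> [[Gy]|[Gy xy yy]]; first by rewrite E// => /andP[].
  by split=> //; rewrite E// xy.
move=> Gy; have dx := dist_boundary_gt0 Gx; have dy := dist_boundary_gt0 Gy.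
have d0 : 0 < Num.min (dist_boundary G x) (dist_boundary G y).
  by rewrite lt_min dx.
rewrite /jmetric -[X in _ < X]expRK ltr_ln ?posrE ?expR_gt0//; last first.
  by rewrite ltr_pwDl// divr_ge0 ?enorm_ge0 ?ltW.
rewrite -ltrBrDl ltr_pdivrMr// -lt_min minr_pMr//.
by rewrite subr_ge0 -expR0 ler_expR.
Qed.

End Boundary.

(** * j-balls in starlike domains *)

Section Starlike.
Variables (R : realType) (n : nat) (G : set 'rV[R]_n) (x : 'rV[R]_n).
Hypotheses (G_open : open G) (G_boundary : boundary G !=set0).
Hypothesis G_star : forall y, G y -> segment x y `<=` G.

(** The homothety with centre x and ratio t sends y to z = (1 - t) x + t y and
    maps G into itself. A boundary point b within t d(y) of z would be the image
    of a point w within d(y) of y, so w and then b would belong to G, but an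
    open set is disjoint from its boundary. *)
Lemma dist_boundary_segment y t : G y -> 0 <= t <= 1 ->
  t * dist_boundary G y <= dist_boundary G ((1 - t) *: x + t *: y).
Proof.
move=> Gy /andP[]; rewrite le_eqVlt => /predU1P[<- _|t0 t1].
  by rewrite mul0r dist_boundary_ge0.
apply: le_dist_boundary => // b; rewrite boundary_open// => -[_ NGb].
rewrite leNgt; apply/negP => zb; apply: NGb.
(* The preimage of b under the homothety. *)
pose w := x + t^-1 *: (b - x).
have bE : b = (1 - t) *: x + t *: w.
  by apply/rowP => i; rewrite !mxE; field; rewrite gt_eqF.
apply: (G_star (y := w)); last first.
  by exists t => //=; rewrite in_itv/= ltW.
apply: (ball_dist_boundary_sub G_open Gy).
rewrite -(ltr_pM2l t0); apply: le_lt_trans zb.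
rewrite -[in leLHS](gtr0_norm t0) -enormZ le_eqVlt; apply/orP; left.
by apply/eqP; congr enorm; apply/rowP => i; rewrite !mxE; field; rewrite gt_eqF.
Qed.

(** Along the segment the distance to x scales by exactly t, while the distance
    to the boundary shrinks by at most the factor t. *)
Lemma jball_segment M y : 0 < M -> G x -> jball G x M y ->
  segment x y `<=` jball G x M.
Proof.
move=> M_gt0 Gx; have M0 := ltW M_gt0.
move=> /(jballP G_open G_boundary _ M0 Gx)[Gy yx yy] _ [t /= + <-].
rewrite in_itv/= => t01; have /andP[t0 t1] := t01.
set z := _ + _; have Gz : G z by apply: (G_star Gy); exists t.
have xz : enorm (x - z) = t * enorm (x - y).
  rewrite -[in RHS](ger0_norm t0) -enormZ; congr enorm.
  by apply/rowP => i; rewrite !mxE; ring.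
have r0 : 0 < expR M - 1 by rewrite subr_gt0 expR_gt1.
apply/(jballP G_open G_boundary _ M0 Gx); split=> //; rewrite xz.
  by apply: le_lt_trans yx; rewrite ler_piMl ?enorm_ge0.
(* Strictness at t = 0, where z = x, comes from d(x) > 0. *)
have [t_eq0|t_neq0] := eqVneq t 0.
  by rewrite t_eq0 mul0r mulr_gt0// dist_boundary_gt0.
apply: (@lt_le_trans _ _ (t * ((expR M - 1) * dist_boundary G y))).
  by rewrite ltr_pM2l// lt_neqAle eq_sym t_neq0.
by rewrite mulrCA ler_pM2l// dist_boundary_segment.
Qed.

(** The two strict inequalities of [jballP] are between continuous functions
    of y. *)
Lemma open_jball M : 0 <= M -> G x -> open (jball G x M).
Proof.
move=> M0 Gx; pose r := expR M - 1.
have -> : jball G x M = G `&`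
    ((fun y => r * dist_boundary G x - enorm (x - y)) @^-1` [set s | 0 < s] `&`
     (fun y => r * dist_boundary G y - enorm (x - y)) @^-1` [set s | 0 < s]).
  apply/seteqP; split=> y /=; rewrite !subr_gt0.
    by move=> /(jballP G_open G_boundary _ M0 Gx)[].
  by move=> [Gy [yx yy]]; apply/(jballP G_open G_boundary _ M0 Gx).
apply: openI => //; apply: openI; apply: open_comp; try exact: open_gt.
- move=> y _; apply: (@continuousB R R^o 'rV[R]_n
    (fun=> r * dist_boundary G x) (fun z => enorm (x - z))).
    exact: cst_continuous.
  exact: enorm_dist_continuous.
- move=> y _; apply: (@continuousB R R^o 'rV[R]_n
    (fun z => r * dist_boundary G z) (fun z => enorm (x - z))).
    apply: (@continuousM R 'rV[R]_n (fun=> r) (dist_boundary G)).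
      exact: cst_continuous.
    exact: dist_boundary_continuous.
  exact: enorm_dist_continuous.
Qed.

End Starlike.

Lemma connected_starshaped (R : realType) (n : nat) (B : set 'rV[R]_n) x :
  (forall y, B y -> segment x y `<=` B) -> connected B.
Proof.
move=> B_star; have -> : B = \bigcup_(y in B) segment x y.
  apply/seteqP; split=> [y By|y [z Bz]]; last exact: B_star.
  by exists y => //; exact: segment_r.
apply: bigcup_connected => [|y _]; last exact: connected_segment.
by exists x => y _; exact: segment_l.
Qed.

Theorem theorem4p8 (R : realType) (n : nat) (n_ge2 : (2 <= n)%N)
    (M : R) (M_gt0 : 0 < M) (G : set 'rV[R]_n) (x : 'rV[R]_n)
    (G_domain : domain G) (G_proper : G `<` setT) (Gx : G x)
    (G_starlike : starlike G x) :
  starlike (jball G x M) x.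
Proof.
have [[_ G_open _] G_bounded _ G_star] := G_starlike.
have G_boundary := boundary_nonempty G_open Gx G_proper.
have Bx : jball G x M x.
  by split=> //; rewrite /jmetric subrr enorm0 mul0r addr0 ln1.
have B_star y : jball G x M y -> segment x y `<=` jball G x M.
  exact: jball_segment.
split=> //; last by apply: sub_boundedr G_bounded => P GP y [/GP].
split; [by exists x| |exact: connected_starshaped B_star].
by apply: open_jball => //; exact: ltW.
Qed.
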